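(* Let $X$ be a compact space and $Y$ a scattered compact space such that $X$ or $Y$ satisfies the countable chain condition, and let $f:X\times Y\to\overline{\mathbb R}$ be a separately continuous function. Then $(\wedge_f,\vee_f)$ is a stable pair of Hahn on $X$.
   Context: Compact spaces are Hausdorff; $Y$ is scattered if every non-empty subset has a point isolated in it. The countable chain condition means every family of pairwise disjoint non-empty open sets is countable. $\overline{\mathbb R}=[-\infty,+\infty]$. $\wedge_f(x)=\inf_{y\in Y}f(x,y)$, $\vee_f(x)=\sup_{y\in Y}f(x,y)$. A pair $(g,h)$ of functions $X\to\overline{\mathbb R}$ is a stable pair of Hahn if there are continuous $u_n:X\to\overline{\mathbb R}$ with $g(x)=\min_{n\in\mathbb N}u_n(x)$ and $h(x)=\max_{n\in\mathbb N}u_n(x)$ for all $x\in X$ (attained). *)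

(* Defs.v *)
From HB Require Import structures.
From mathcomp Require Import all_boot all_order all_algebra.
From mathcomp Require Import all_classical all_reals all_analysis.
Set Implicit Arguments. Unset Strict Implicit. Unset Printing Implicit Defensive.
Import Order.TTheory GRing.Theory Num.Theory.
Local Open Scope classical_set_scope.
Local Open Scope ereal_scope.

Definition scattered (Y : topologicalType) : Prop :=
  forall A : set Y, A !=set0 -> exists y, isolated A y.

Definition ccc (T : topologicalType) : Prop :=
  forall F : set (set T),
    (forall U, F U -> open U /\ U !=set0) ->
    (forall U V, F U -> F V -> U <> V -> U `&` V = set0) ->
    countable F.

Definition separately_continuous (X Y : topologicalType) (R : realType)
  (f : X * Y -> \bar R) : Prop :=
  (forall y : Y, continuous (fun x : X => f (x, y))) /\
  (forall x : X, continuous (fun y : Y => f (x, y))).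

Definition wedge_f (X Y : Type) (R : realType) (f : X * Y -> \bar R) : X -> \bar R :=
  fun x => ereal_inf (range (fun y : Y => f (x, y))).

Definition vee_f (X Y : Type) (R : realType) (f : X * Y -> \bar R) : X -> \bar R :=
  fun x => ereal_sup (range (fun y : Y => f (x, y))).

Definition stable_pair_Hahn (X : topologicalType) (R : realType)
  (g h : X -> \bar R) : Prop :=
  exists u : nat -> X -> \bar R,
    (forall n, continuous (u n)) /\
    (forall x : X,
       ((exists n, g x = u n x) /\ (forall n, g x <= u n x)) /\
       ((exists n, h x = u n x) /\ (forall n, u n x <= h x))).

(* Main.v *)
(* It suffices that [f] has only countably many distinct sections [f(., y)]: they
   then form the sequence [u], the extrema being attained since [Y] is compact.
   First, for every [y0] some countable subset of [X] suffices to tell [f(., y0)]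
   from the other sections. If [X] is ccc, this comes from a maximal disjoint
   family of open sets [V], each with a finite set [S] such that a section equal
   to [f(., y0)] on [S] is close to it on [V]; such [V] lie in every nonempty open
   set, by a double limit argument. If [Y] is ccc, its isolated points form a
   countable dense set, along which [X] has countably many finite nets.
   Next, if the set [N] of points of [Y] without a neighborhood carrying countably
   many sections were nonempty, it would have an isolated point [y0]. A closed
   neighborhood of [y0] meeting [N] only at [y0] is covered by the [y] with
   [f(., y) = f(., y0)] and by countably many compact sets disjoint from [N],
   each carrying countably many sections: a contradiction. So [N] is empty, and
   the compact space [Y] carries countably many sections. *)
Require Import Defs.
From HB Require Import structures.
From mathcomp Require Import all_boot all_order all_algebra.
From mathcomp Require Import all_classical all_reals all_analysis.
Set Implicit Arguments. Unset Strict Implicit. Unset Printing Implicit Defensive.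
Import Order.TTheory GRing.Theory Num.Theory.
Import numFieldNormedType.Exports.
Local Open Scope classical_set_scope.
Local Open Scope ring_scope.

(** * Cluster points and the double limit argument *)

Lemma compact_seq_cluster (T : topologicalType) (u : nat -> T) :
  compact [set: T] -> exists p, cluster (u @ \oo) p.
Proof.
by move=> cT; have [|p [_ pu]] := cT (u @ \oo) _; [exact: filterT|exists p].
Qed.

Lemma cluster_seq_closed (T : topologicalType) (u : nat -> T) (C : set T) k p :
  closed C -> (forall n, (k <= n)%N -> C (u n)) -> cluster (u @ \oo) p -> C p.
Proof. by move=> cC uC up; apply: cC => B; apply: up; exists k. Qed.

Lemma continuous_dist (T : topologicalType) (R : realType) (a b : T -> R) :
  continuous a -> continuous b -> continuous (fun x => `|a x - b x|).
Proof.
move=> ca cb x.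
by apply: (@cvg_norm R R^o); apply: (@cvgB R R^o); [exact: ca|exact: cb].
Qed.

Lemma open_dist_gt (T : topologicalType) (R : realType) (a b : T -> R) e :
  continuous a -> continuous b -> open [set x | e < `|a x - b x|].
Proof.
move=> ca cb; apply: (@open_comp _ _ _ [set r | e < r]); last exact: open_gt.
by move=> x _; exact: continuous_dist.
Qed.

Lemma closed_dist_ge (T : topologicalType) (R : realType) (a b : T -> R) e :
  continuous a -> continuous b -> closed [set x | e <= `|a x - b x|].
Proof.
move=> ca cb; apply: (@closed_comp _ _ _ [set r | e <= r]); last exact: closed_ge.
by move=> x _; exact: continuous_dist.
Qed.

Lemma closed_dist_le (T : topologicalType) (R : realType) (a b : T -> R) e :
  continuous a -> continuous b -> closed [set x | `|a x - b x| <= e].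
Proof.
move=> ca cb; apply: (@closed_comp _ _ _ [set r | r <= e]); last exact: closed_le.
by move=> x _; exact: continuous_dist.
Qed.

Lemma closed_eqfun (T : topologicalType) (R : realType) (a b : T -> R) :
  continuous a -> continuous b -> closed [set x | a x = b x].
Proof.
move=> ca cb.
rewrite (_ : mkset _ = (fun x => `|a x - b x|) @^-1` [set r | r = 0]).
  apply: closed_comp; last exact: closed_eq.
  by move=> x _; exact: continuous_dist.
rewrite predeqE => x /=; split=> [->|/eqP]; first by rewrite subrr normr0.
by rewrite normr_eq0 subr_eq0 => /eqP.
Qed.

(* Grothendieck's double limit argument: at cluster points [x] of [u] and [y] of
   [v], taking the limits in the two orders gives both [g x y = g x y0] and
   [e <= `|g x y - g x y0|]. *)
Lemma double_limit_absurd (R : realType) (X Y : topologicalType) (g : X -> Y -> R)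
    (y0 : Y) (e : R) (u : nat -> X) (v : nat -> Y) :
  compact [set: X] -> compact [set: Y] ->
  (forall y, continuous (g^~ y)) -> (forall x, continuous (g x)) -> 0 < e ->
  (forall n m, (n < m)%N -> g (u n) (v m) = g (u n) y0) ->
  ~ (forall n m, (m <= n)%N -> e <= `|g (u n) (v m) - g (u n) y0|).
Proof.
move=> cX cY gX gY e0 uv0 uve.
have [x ux] := compact_seq_cluster u cX.
have [y vy] := compact_seq_cluster v cY.
have xy0 : g x y = g x y0.
  apply: (@cluster_seq_closed _ u [set x | g x y = g x y0] 0%N x _ _ ux).
    exact: (closed_eqfun (gX _) (gX _)).
  move=> n _.
  apply: (@cluster_seq_closed _ v [set y | g (u n) y = g (u n) y0] n.+1 y _ _ vy).
    by apply: closed_eqfun => //; exact: cst_continuous.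
  by move=> m; exact: uv0.
have : e <= `|g x y - g x y0|.
  apply: (@cluster_seq_closed _ v [set y | e <= `|g x y - g x y0|] 0%N y _ _ vy).
    by apply: closed_dist_ge => //; exact: cst_continuous.
  move=> m _.
  apply: (@cluster_seq_closed _ u
    [set x | e <= `|g x (v m) - g x y0|] m x _ _ ux).
    exact: (closed_dist_ge (gX _) (gX _)).
  by move=> n; exact: uve.
by rewrite xy0 subrr normr0 leNgt e0.
Qed.

(** * Separating sets when [X] is ccc *)

(** Were there no such [V], points [a_n] of [U] and [b_n] of [Y] could be chosen in turn so that
    [b_n] agrees with [y0] at all earlier [a_i], while at [a_n] each of [b_0, ..., b_n] is more than
    [e] away from [y0]. The double limit argument forbids this. *)
Lemma small_open_subset (R : realType) (X Y : topologicalType) (g : X -> Y -> R)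
    (y0 : Y) (e : R) (U : set X) :
  compact [set: X] -> compact [set: Y] ->
  (forall y, continuous (g^~ y)) -> (forall x, continuous (g x)) -> 0 < e ->
  open U -> U !=set0 ->
  exists V (S : seq X), [/\ open V, V !=set0, V `<=` U &
    forall y, (forall s, s \in S -> g s y = g s y0) ->
      forall x, V x -> `|g x y - g x y0| <= e].
Proof.
move=> cX cY gX gY e0 oU [xU UxU]; apply: contrapT => noV.
pose V (s : seq (X * Y)) :=
  [set x | U x /\ forall p, p \in s -> e < `|g x p.2 - g x y0|].
have oV s : open (V s).
  elim: s => [|p s IHs]; first by rewrite (_ : V _ = U)// eqEsubset; split=> // x [].
  rewrite (_ : V _ = V s `&` [set x | e < `|g x p.2 - g x y0|]).
    by apply: openI => //; exact: (open_dist_gt _ (gX _) (gX _)).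
  rewrite predeqE => x /=; split=> [[Ux xps]|[[Ux xs] xp]].
    split; last by apply: xps; rewrite mem_head.
    by split=> // q qs; apply: xps; rewrite inE qs orbT.
  by split=> // q; rewrite inE => /predU1P[->//|]; exact: xs.
(* The failure is applied to [V s] and the first components of [s]; [(xU, y0)] is a dummy value for
   empty [V s], a case excluded by [hist0]. *)
have /choice[step stepP] : forall s, exists p, V s !=set0 ->
    V (p :: s) p.1 /\ forall q, q \in s -> g q.1 p.2 = g q.1 y0.
  move=> s; have [V0|] := pselect (V s !=set0); last by exists (xU, y0).
  apply: contrapT => nop; apply: noV; exists (V s), (map fst s); split=> //.
    by move=> x [].
  move=> y ys x Vx; rewrite leNgt; apply/negP => exy.
  apply: nop; exists (x, y) => _; split.
    by split=> [|q]; [case: Vx|rewrite inE => /predU1P[->//|]; case: Vx => _; exact].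
  by move=> q qs; apply: ys; exact: map_f.
pose hist := fix hist n := if n is n'.+1 then step (hist n') :: hist n' else [::].
have hist0 n : V (hist n) !=set0.
  elim: n => [|n IHn]; first by exists xU.
  by exists (step (hist n)).1; case: (stepP _ IHn).
have mem_hist n m : (m < n)%N -> step (hist m) \in hist n.
  elim: n => // n IHn; rewrite ltnS leq_eqVlt => /predU1P[->|/IHn mn] /=.
    by rewrite mem_head.
  by rewrite inE mn orbT.
apply: (@double_limit_absurd R X Y g y0 e (fun n => (step (hist n)).1)
  (fun n => (step (hist n)).2)) => // n m nm.
  by have [_] := stepP _ (hist0 m); apply; exact: mem_hist.
have [[_ Vn] _] := stepP _ (hist0 n); apply/ltW/Vn.
exact: (@mem_hist n.+1).
Qed.

Lemma ccc_left_small (R : realType) (X Y : topologicalType) (g : X -> Y -> R)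
    (y0 : Y) (e : R) :
  compact [set: X] -> compact [set: Y] ->
  (forall y, continuous (g^~ y)) -> (forall x, continuous (g x)) -> ccc X ->
  0 < e ->
  exists2 S : set X, countable S & forall y,
    (forall s, S s -> g s y = g s y0) -> forall x, `|g x y - g x y0| <= e.
Proof.
move=> cX cY gX gY cccX e0.
pose small (V : set X) (S : seq X) := forall y,
  (forall s, s \in S -> g s y = g s y0) -> forall x, V x -> `|g x y - g x y0| <= e.
have /choice[S_ S_P] : forall V, exists S, (exists S', small V S') -> small V S.
  move=> V; have [[S VS]|] := pselect (exists S', small V S'); first by exists S.
  by exists [::].
pose D := [set V | [/\ open V, V !=set0 & exists S, small V S]].
have [E [ED tE maxE]] := ex_maximal_disjoint_subcollection (@id (set X)) D.
have cE : countable E.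
  apply: cccX => [V /ED[]//|V W EV EW VW].
  by apply: contrapT => /eqP/set0P VW0; apply: VW; exact: tE.
exists (\bigcup_(V in E) [set` S_ V]).
  by apply: bigcup_countable => // V _; exact: finite_set_countable.
move=> y yS x; rewrite leNgt; apply/negP => exy.
have [] := @small_open_subset R X Y g y0 e [set x | e < `|g x y - g x y0|]
  cX cY gX gY e0.
- exact: (open_dist_gt _ (gX _) (gX _)).
- by exists x.
move=> V [S [oV [z Vz] Vy VS]].
(* On members of [E] the point [y] is within [e] of [y0], so [V] misses them all and could be added
   to [E], against maximality. *)
have EVdisj W t : E W -> W t -> V t -> False.
  move=> EW Wt /Vy/=; apply/negP; rewrite -leNgt.
  have [_ _ /S_P SW] := ED _ EW.
  by apply: SW => // s sS; apply: yS; exists W.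
apply: (maxE (E `|` [set V])).
- split; first by move=> W EW; left.
  by move=> /(_ V (or_intror erefl)) EV; exact: (EVdisj V z).
- move=> W [/ED//|->]; split=> //; first by exists z.
  by exists S.
- move=> A B [EA|->] [EB|->] // [t [At Bt]].
  + by apply: tE => //; exists t.
  + by case: (EVdisj _ _ EA At Bt).
  + by case: (EVdisj _ _ EB Bt At).
Qed.

Lemma dist_le_invn_eq (R : realType) (a b : R) :
  (forall n : nat, `|a - b| <= n.+1%:R^-1) -> a = b.
Proof.
move=> ab; apply/eqP; rewrite -subr_eq0 -normr_le0 leNgt; apply/negP => ab0.
have [N _ /(_ N (leqnn N))/=] := near_infty_natSinv_lt (PosNum ab0).
by rewrite ltNge ab.
Qed.

(** The union of the countable sets for [e = 1/(n+1)] turns closeness into equality. *)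
Lemma ccc_left_separating (R : realType) (X Y : topologicalType) (g : X -> Y -> R)
    (y0 : Y) :
  compact [set: X] -> compact [set: Y] ->
  (forall y, continuous (g^~ y)) -> (forall x, continuous (g x)) -> ccc X ->
  exists2 S : set X, countable S & forall y,
    (forall s, S s -> g s y = g s y0) -> forall x, g x y = g x y0.
Proof.
move=> cX cY gX gY cccX.
have /choice[S SP] : forall n : nat, exists S : set X, countable S /\ forall y,
    (forall s, S s -> g s y = g s y0) -> forall x, `|g x y - g x y0| <= n.+1%:R^-1.
  move=> n; have [|S cS SP] := @ccc_left_small R X Y g y0 n.+1%:R^-1 cX cY gX gY cccX.
    by rewrite invr_gt0.
  by exists S.
exists (\bigcup_n S n); first by apply: bigcup_countable => // n _; case: (SP n).
move=> y yS x; apply: dist_le_invn_eq => n.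
by have [_] := SP n; apply=> s Ss; apply: yS; exists n.
Qed.

(** * Ideals of sets on compact spaces; separating sets when [Y] is ccc *)

Lemma compact_ideal (T : topologicalType) (K : set T) (I : set T -> Prop) :
  compact K -> (forall A B, A `<=` B -> I B -> I A) -> I set0 ->
  (forall A B, I A -> I B -> I (A `|` B)) ->
  (forall x, K x -> exists2 W, nbhs x W & I W) -> I K.
Proof.
move=> cK Isub I0 IU Iloc; apply: contrapT => nIK.
(* If [I K] failed, the sets whose complement in [K] is in [I] would form a
   proper filter without cluster point in [K]. *)
pose F : set_system T := [set A | I (K `\` A)].
have FF : ProperFilter F.
  split; first by rewrite /F /= setD0.
  split=> [|A B FA FB|A B AB]; rewrite /F /=.
  - by rewrite setDT.
  - by rewrite setDIr; exact: IU.
  - by apply: Isub; apply: setDS.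
have [|p [Kp Fp]] := cK F FF; first by rewrite /F /= setDv.
have [W pW IW] := Iloc p Kp.
have [|t [nWt Wt]] := Fp (~` W) W _ pW; last exact: nWt.
by apply: Isub IW => t [_ /contrapT].
Qed.

(** The open singletons are pairwise disjoint, hence countably many. They meet every nonempty open
    set, since a point isolated in an open set is isolated in [Y]. *)
Lemma scattered_ccc_dense (Y : topologicalType) :
  scattered Y -> ccc Y -> exists2 D : set Y, countable D & dense D.
Proof.
move=> sY cccY; exists [set y | open [set y]].
  have /countable_injP[h h_inj] : countable (set1 @` [set y : Y | open [set y]]).
    apply: cccY => [_ [y oy <-]|_ _ [y _ <-] [z _ <-] yz]; first by split=> //; exists y.
    rewrite -subset0 => t [/= ty tz]; apply: yz; by rewrite -ty -tz.
  apply/countable_injP; exists (h \o set1) => y z /set_mem yD /set_mem zD /= yz.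
  have : [set y] = [set z].
    by apply: h_inj => //; rewrite inE; [exists y|exists z].
  by move=> yzE; have : [set z] y by rewrite -yzE.
move=> O O0 oO; have [y [/set_mem Oy [V yV VO]]] := sY O O0.
have yE : [set y] = V° `&` O.
  rewrite eqEsubset; split=> [_ ->|z [/interior_subset Vz Oz]]; first by split.
  by rewrite -VO.
exists y; split=> //; change (open [set y]); rewrite yE.
by apply: openI => //; exact: open_interior.
Qed.

(** Net points ever closer to [x] along [D] cluster at some [z] with [g z = g x] on [D], hence
    everywhere. Agreement of [y] and [y0] on the nets passes to [z], and so to [x]. *)
Lemma dense_right_separating (R : realType) (X Y : topologicalType)
    (g : X -> Y -> R) (y0 : Y) (D : set Y) :
  compact [set: X] ->
  (forall y, continuous (g^~ y)) -> (forall x, continuous (g x)) ->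
  countable D -> dense D ->
  exists2 S : set X, countable S & forall y,
    (forall s, S s -> g s y = g s y0) -> forall x, g x y = g x y0.
Proof.
move=> cX gX gY cD dD.
have [d dP] : exists d : nat -> Y, forall y, D y -> exists n, d n = y.
  have /pfcard_geP[D0|[d]] := cD.
    by exists (fun=> y0) => y; rewrite D0.
  by exists d => y /(@surj _ _ _ _ d)[n _]; exists n.
(* [S n] is a finite net of [X] for the pseudometric
   [max_(i < n) `|g s (d i) - g x (d i)|]. *)
have /choice[S SP] : forall n : nat, exists S : seq X, forall x, exists2 s, s \in S &
    forall i, (i < n)%N -> `|g s (d i) - g x (d i)| <= n.+1%:R^-1.
  move=> n; pose I (A : set X) := exists S : seq X, forall x, A x -> exists2 s, s \in S &
    forall i, (i < n)%N -> `|g s (d i) - g x (d i)| <= n.+1%:R^-1.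
  have [] : I [set: X]; last by move=> S SP; exists S => x; exact: SP.
  apply: compact_ideal => //.
  - by move=> A B AB [S SP]; exists S => x /AB/SP.
  - by exists [::].
  - move=> A B [S SP] [S' S'P]; exists (S ++ S') => x [/SP|/S'P] [s sS sP].
      by exists s => //; rewrite mem_cat sS.
    by exists s => //; rewrite mem_cat sS orbT.
  - move=> x _.
    exists [set z | forall i, (i < n)%N -> `|g x (d i) - g z (d i)| <= n.+1%:R^-1]; last first.
      by exists [:: x] => z zP; exists x => //; rewrite mem_head.
    have xi i : \forall z \near x, `|g x (d i) - g z (d i)| <= n.+1%:R^-1.
      have /cvgr_dist_le := gX (d i) x.
      by apply; rewrite invr_gt0.
    (* The precision keeps [n] fixed while the number [k] of conditions varies, which allows
       induction on [k]. *)
    have {}xi k : \forall z \near x, forall i, (i < k)%N ->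
        `|g x (d i) - g z (d i)| <= n.+1%:R^-1.
      elim: k => [|k IHk]; first exact: nearW.
      move: (xi k); apply: filterS2 IHk => z zk1 zk i.
      by rewrite ltnS leq_eqVlt => /predU1P[->|/zk1].
    exact: xi.
exists (\bigcup_n [set` S n]).
  by apply: bigcup_countable => // n _; exact: finite_set_countable.
move=> y yS x.
have /choice[u uP] := fun n => let: ex_intro2 s sS sx := SP n x in
  ex_intro (fun s => s \in S n /\ forall i, (i < n)%N ->
    `|g s (d i) - g x (d i)| <= n.+1%:R^-1) s (conj sS sx).
have [z uz] := compact_seq_cluster u cX.
have zx : forall y, g z y = g x y.
  have zxd i : g z (d i) = g x (d i).
    apply: dist_le_invn_eq => k.
    (* From index [maxn k i.+1] on, [d i] is among the points controlled by the net and the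
       precision is at least that of [k]. *)
    apply: (@cluster_seq_closed _ u
      [set z | `|g z (d i) - g x (d i)| <= k.+1%:R^-1] (maxn k i.+1) z _ _ uz).
      by apply: closed_dist_le => //; exact: cst_continuous.
    move=> n; rewrite geq_max => /andP[kn ni] /=.
    have [_ /(_ i ni)/le_trans] := uP n; apply.
    by rewrite lef_pV2 ?posrE// ler_nat.
  move=> t; apply: contrapT => zxt.
  have [||s [zxs /dP[i ds]]] := dD (~` [set t | g z t = g x t]).
  - by exists t.
  - by apply: closed_openC; exact: closed_eqfun.
  - by apply: zxs; rewrite /= -ds.
rewrite -!zx.
apply: (@cluster_seq_closed _ u [set z | g z y = g z y0] 0%N z _ _ uz).
  exact: (closed_eqfun (gX _) (gX _)).
by move=> n _; apply: yS; exists n => //; case: (uP n).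
Qed.

(** * Countability of the set of sections *)

Lemma scattered_countable_sections (R : realType) (X Y : topologicalType)
    (g : X -> Y -> R) :
  hausdorff_space Y -> compact [set: Y] -> scattered Y ->
  (forall x, continuous (g x)) ->
  (forall y0, exists2 S : set X, countable S & forall y,
    (forall s, S s -> g s y = g s y0) -> forall x, g x y = g x y0) ->
  countable (range (fun y => g^~ y)).
Proof.
move=> hY cY sY gY sep.
pose ctbl (A : set Y) := countable ((fun y => g^~ y) @` A).
have ctbl_sub A B : A `<=` B -> ctbl B -> ctbl A.
  by move=> AB; apply: sub_countable; exact/subset_card_le/image_subset.
have ctbl0 : ctbl set0 by rewrite /ctbl image_set0.
have ctbl_bigcup (I : Type) (E : set I) (F : I -> set Y) : countable E ->
    (forall i, E i -> ctbl (F i)) -> ctbl (\bigcup_(i in E) F i).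
  by move=> cE cF; rewrite /ctbl image_bigcup; exact: bigcup_countable.
have ctblU A B : ctbl A -> ctbl B -> ctbl (A `|` B).
  move=> cA cB; apply: (@ctbl_sub _ (\bigcup_(b : bool) if b then A else B)).
    by move=> y [Ay|By]; [exists true|exists false].
  by apply: ctbl_bigcup => // -[].
pose N := [set y : Y | forall W, nbhs y W -> ~ ctbl W].
have N0 y : ~ N y -> exists2 W, nbhs y W & ctbl W.
  move=> nNy; apply: contrapT => nW; apply: nNy => W yW cW.
  by apply: nW; exists W.
apply: (compact_ideal cY ctbl_sub) => // y _; apply: (N0) => Ny.
have [y0 [/set_mem Ny0 [V y0V VN]]] := sY N (ex_intro _ y Ny).
have [W y0W WV] := compact_regular hY cY (filterT : nbhs y0 setT) y0V.
apply: (Ny0 W y0W).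
have [S cS SP] := sep y0.
(* [C s n] is compact and excludes [y0], the only point of [N] in [closure W], so it misses [N]. A
   point of [W] outside all of them agrees with [y0] on [S], hence has the same section. *)
pose C (s : X) (n : nat) := closure W `&` [set y | n.+1%:R^-1 <= `|g s y - g s y0|].
apply: (@ctbl_sub _ ([set y | g^~ y = g^~ y0] `|` \bigcup_(s in S) \bigcup_n C s n)).
  move=> z Wz; apply: contrapT => /not_orP[zy0 zC]; apply: zy0.
  apply/funext; apply: SP => s Ss; apply: dist_le_invn_eq => n.
  rewrite leNgt; apply/negP => /ltW nz; apply: zC.
  by exists s => //; exists n => //; split=> //; exact: subset_closure.
apply: (ctblU).
  apply: (@sub_countable _ _ _ [set g^~ y0]) => //; apply: subset_card_le.
  by move=> _ [z /= zy0 <-].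
apply: (ctbl_bigcup) => // s _; apply: (ctbl_bigcup) => // n _.
apply: (@compact_ideal Y (C s n) ctbl) => //.
  apply: (subclosed_compact _ cY) => //; apply: closedI; first exact: closed_closure.
  by apply: closed_dist_ge => //; exact: cst_continuous.
move=> z [Wz /= nz]; apply: N0 => Nz; move: nz.
have : (V `&` N) z by split=> //; exact: WV.
by rewrite VN => ->; rewrite subrr normr0 leNgt invr_gt0 ltr0n.
Qed.

(** * Extended real values and attained extrema *)

Lemma continuous_contract (R : realType) : continuous (@contract R).
Proof.
move=> x; apply/cvg_ballP => e e0.
exact: (@nbhsx_ballx _ _ x e e0).
Qed.

Theorem theorem4p3 (R : realType) (X Y : topologicalType)
  (hX : hausdorff_space X) (cX : compact [set: X])
  (hY : hausdorff_space Y) (cY : compact [set: Y])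
  (nY : [set: Y] !=set0)
  (sY : scattered Y) (cccXY : ccc X \/ ccc Y)
  (f : X * Y -> \bar R) (sf : separately_continuous f) :
  stable_pair_Hahn (wedge_f f) (vee_f f).
Proof.
have [fX fY] := sf.
(* [contract] is an increasing injection into the reals: distances between values become available,
   while equalities and extrema transfer back to [f]. *)
pose g x y := contract (f (x, y)).
have gX y : continuous (g^~ y).
  by move=> x; apply: continuous_comp; [exact: fX|exact: continuous_contract].
have gY x : continuous (g x).
  by move=> y; apply: continuous_comp; [exact: fY|exact: continuous_contract].
have /pfcard_geP[range0|[u]] : countable (range (fun y => g^~ y)).
  apply: scattered_countable_sections => // y0.
  case: cccXY => [cccX|/(scattered_ccc_dense sY)[D cD dD]].
    exact: ccc_left_separating.
  exact: (dense_right_separating y0 cX gX gY cD dD).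
  by case: nY => y _; have : set0 (g^~ y) by rewrite -range0; exists y.
have /choice[v vP] n : exists y, u n = g^~ y.
  by have [y _ yu] := @funS _ _ _ _ u n I; exists y.
have fv y : exists n, forall x, f (x, y) = f (x, v n).
  have [|n _ un] := @surj _ _ _ _ u (g^~ y); first by exists y.
  exists n => x; apply: contract_inj.
  exact: (congr1 (fun h => h x) (etrans (esym un) (vP n))).
exists (fun n x => f (x, v n)); split=> [n|x]; first exact: fX.
have cgx : {within [set: Y], continuous (g x)} by exact: continuous_subspaceT.
split; split.
(* The minimum over [Y] is attained at some [y] depending on [x]; [fv] replaces it by a [v n] with
   the same section. *)
- have [y _ ymin] := compact_EVT_min nY cY cgx.
  have [n fn] := fv y; exists n; rewrite -fn; apply/eqP; rewrite eq_le; apply/andP; split.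
    by apply: ereal_inf_lbound; exists y.
  by apply: le_ereal_inf_tmp => _ [t _ <-]; rewrite -le_contract; apply: ymin; rewrite inE.
- by move=> n; apply: ereal_inf_lbound; exists (v n).
- have [y _ ymax] := compact_EVT_max nY cY cgx.
  have [n fn] := fv y; exists n; rewrite -fn; apply/eqP; rewrite eq_le; apply/andP; split.
    by apply: ge_ereal_sup => _ [t _ <-]; rewrite -le_contract; apply: ymax; rewrite inE.
  by apply: ereal_sup_ubound; exists y.
- by move=> n; apply: ereal_sup_ubound; exists (v n).
Qed.
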